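(* Let $f:[a,b]\to[c,d]$ be a fixed Riemann integrable function on $[a,b]$, and suppose that there is no (nondegenerate) interval contained in $[a,b]$ on which $f$ is constant. Then the following are equivalent: (i) for every Riemann integrable function $G:[c,d]\to\mathbb{R}$, the composition $G\circ f$ is Riemann integrable on $[a,b]$; (ii) $f$ has the $N^{-1}$-property.
   Context: Here $a<b$ and $c<d$ are real numbers and $\lambda$ is Lebesgue measure on $\mathbb{R}$. For $A\subset\mathbb{R}$, a function $f:A\to\mathbb{R}$ is said to have the $N^{-1}$-property if for each set $N\subset\mathbb{R}$ with $\lambda(N)=0$ one has $\lambda(f^{-1}(N))=0$, where $f^{-1}(N)$ is the preimage of $N$ under $f$. *)

(* Defs.v *)
From Stdlib Require Reals.
From Coquelicot Require Coquelicot.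
From mathcomp Require Export all_boot all_order all_algebra.
From mathcomp Require Export all_classical all_reals all_analysis.
From mathcomp Require Export Rstruct Rstruct_topology.

Set Implicit Arguments.
Unset Strict Implicit.
Unset Printing Implicit Defensive.

Local Open Scope classical_set_scope.
Local Open Scope ring_scope.

Notation Real := Rdefinitions.R.

(* A function on A (a subset of R) is represented by a total function on R
   whose values outside of A are irrelevant. *)

(* For u < v, [ex_RInt g u v] is convergence of the tagged Riemann sums of g
   over partitions of [u, v] as the mesh tends to 0; all tags lie in [u, v]. *)
Definition Riemann_integrable_on (u v : Real) (g : Real -> Real) : Prop :=
  @Coquelicot.RInt.ex_RInt Coquelicot.Hierarchy.R_NormedModule g u v.

(* [lebesgue_measure] is the measure on the Borel sigma-algebra; a subset of R
   is [negligible] for it when it is contained in a Borel set of measure 0,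
   i.e., when it is Lebesgue measurable of Lebesgue measure 0. *)
Definition N_inv_property (A : set Real) (f : Real -> Real) : Prop :=
  forall N : set Real,
    (@lebesgue_measure Real).-negligible N ->
    (@lebesgue_measure Real).-negligible (A `&` f @^-1` N).

(* [is_interval] also holds of the empty set and of singletons, whence the two
   distinct points. *)
Definition constant_on_some_interval (A : set Real) (f : Real -> Real) : Prop :=
  exists I : set Real,
    [/\ is_interval I,
        exists x y : Real, [/\ I x, I y & x < y],
        I `<=` A &
        exists k : Real, forall x, I x -> f x = k].

(* Main.v *)
Require Import Defs.
From Coquelicot Require Coquelicot.
From mathcomp Require Import lra measurable_realfun.
Import Coquelicot.RInt Coquelicot.SF_seq.
Import Stdlib.Reals.RList Stdlib.Reals.RiemannInt_SF.

Set Implicit Arguments.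
Unset Strict Implicit.
Unset Printing Implicit Defensive.

Import Order.TTheory GRing.Theory Num.Theory.
Import numFieldNormedType.Exports.

Local Open Scope classical_set_scope.
Local Open Scope ring_scope.

(** Both directions rest on Lebesgue's criterion: [g] is Riemann integrable on
    [[u, v]] if and only if it is bounded there and almost every point of
    [[u, v]] is a continuity point ([bounded_of_ex_RInt],
    [ae_continuous_of_ex_RInt], [ex_RInt_of_ae_continuous]).

    If [f] has the N^-1 property, then [G \o f] can only be discontinuous at a
    discontinuity of [f] or at a point that [f] sends to a discontinuity of [G]
    (or to [c] or [d], where nothing is known about [G] on one side). Both sets
    are null, so [G \o f] is integrable ([comp_integrable]).

    Conversely, suppose that composition with [f] preserves integrability.
    The functions [G] to test are the indicators of subsets [S] of a closed null
    set [K]: all their discontinuities lie in [K], whatever [S] is.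
    - With [S = K = {p}], a continuity point of [G \o f] in the fibre of [p]
      would have a neighbourhood on which [f] is constantly [p]; there is none,
      so the fibre is null ([level_set_negligible]).
    - Let [C] be a compact set of continuity points of [f] with null image.
      Then [K = f(C)] is compact. Let [S] be the image of a countable dense
      subset of [C]. Then [G \o f] is 1 on a dense subset of [C], and it
      vanishes almost everywhere because the preimage of [S] is a countable
      union of null fibres. Hence [G \o f] is discontinuous at every point of
      [C], and [C] is null ([compact_negligible]).
    - For a general null set [N], cover [N] by open sets [U_n] of measure
      tending to 0. Off the discontinuities of [f], the preimage of [N] is
      contained in the intersection of the interiors of the preimages of the
      [U_n], a Borel set with null image ([negligible_preimage_hull]). Its
      compact subsets consisting of continuity points are null by the previous
      step, hence so is the preimage of [N] by inner regularity ([N_inv]). *)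

Local Notation mu := (@lebesgue_measure _).
Local Notation Riemann_sum := (@Riemann_sum Hierarchy.R_ModuleSpace).
Local Notation has_RInt := (@is_RInt Hierarchy.R_NormedModule).

(** * Squeezing between Riemann integrable functions *)

Lemma RInt_riemann_sum_cvg (u v : Real) (g : Real -> Real) (l e : Real) :
  u < v -> 0 < e -> has_RInt g u v l ->
  Riemann_fine u v (fun p => `|Riemann_sum g p - l| < e).
Proof.
move=> uv e0 gl.
have e0' : Rdefinitions.Rlt (Rdefinitions.IZR BinNums.Z0) e by apply/RltP.
have [+ _] := @Hierarchy.filterlim_locally _ Hierarchy.R_UniformSpace
  (Riemann_fine u v) _
  (fun p => Rdefinitions.Rmult (Rcomplements.sign (Rdefinitions.Rminus v u))
     (Riemann_sum g p)) l.
move=> /(_ gl (RIneq.mkposreal e e0')).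
apply: Hierarchy.filter_imp => p /=.
rewrite /Hierarchy.ball /= /Hierarchy.AbsRing_ball /=.
rewrite Rcomplements.sign_eq_1; last first.
  by apply/RltP; rewrite RminusE subr_gt0.
rewrite RmultE mul1r.
by move=> /RltP; rewrite /Hierarchy.abs /= RabsE.
Qed.

(** Two Riemann sums of [f] over fine partitions are close: each differs from
    the corresponding sum of [g] by at most the sum of [h], the sums of [g] are
    close to each other and those of [h] are small. The Cauchy criterion then
    applies. *)
Lemma ex_RInt_squeeze (u v : Real) (f : Real -> Real) : u < v ->
  (forall e : Real, 0 < e -> exists (g h : Real -> Real) (l : Real),
   [/\ Riemann_integrable_on u v g,
     has_RInt h u v l, l <= e &
     forall x : Real, u <= x <= v -> `|f x - g x| <= h x]) ->
  Riemann_integrable_on u v f.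
Proof.
move=> uv fgh.
have [+ _] := @Hierarchy.filterlim_locally_cauchy _ Hierarchy.R_CompleteSpace
  (Riemann_fine u v) _ (fun p => Rdefinitions.Rmult
     (Rcomplements.sign (Rdefinitions.Rminus v u))
     (Riemann_sum f p)).
apply=> -[e e0'].
have e0 : 0 < e by apply/RltP.
have e8 : 0 < e / 8 by lra.
have [g [h [l [[k gk] hl le fg]]]] := fgh _ e8.
have Fg := RInt_riemann_sum_cvg uv e8 gk.
have Fh := RInt_riemann_sum_cvg uv e8 hl.
set D : SF_seq -> Prop := fun p => pointed_subdiv p /\
  SF_h p = Rbasic_fun.Rmin u v /\ last (SF_h p) (SF_lx p) = Rbasic_fun.Rmax u v.
have FD : Riemann_fine u v D.
  by rewrite /Riemann_fine /Hierarchy.within; apply: Hierarchy.filter_forall.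
exists (fun p => [/\ `|Riemann_sum g p - k| < e / 8,
  `|Riemann_sum h p - l| < e / 8 & D p]); split.
  apply: Hierarchy.filter_imp
    (Hierarchy.filter_and _ _ Fg (Hierarchy.filter_and _ _ Fh FD)).
  by move=> p [? []].
have minuv : Rbasic_fun.Rmin u v = u by rewrite RminE; apply/min_idPl/ltW.
have maxuv : Rbasic_fun.Rmax u v = v by rewrite RmaxE; apply/max_idPr/ltW.
have RSfg p : D p ->
    `|Riemann_sum f p - Riemann_sum g p| <= Riemann_sum h p.
  rewrite /D minuv maxuv => -[Dp [pu pv]].
  have := @Riemann_sum_norm Hierarchy.R_NormedModule
    (fun x => f x - g x) h p Dp.
  have -> : Riemann_sum (fun x => f x - g x) p =
     (Riemann_sum f p - Riemann_sum g p).
    exact: (@Riemann_sum_minus Hierarchy.R_ModuleSpace f g p).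
  rewrite /Hierarchy.norm /= /Hierarchy.abs /= RabsE => RS.
  apply/RleP; apply: RS => t [].
  move=> /RleP ut /RleP tv; move: ut (tv : t <= last (SF_h p) (SF_lx p)).
  rewrite pv pu => {}ut {}tv.
  by apply/RleP; rewrite RabsE; apply: fg; rewrite ut tv.
move=> p q [gp hp Dp] [gq hq Dq].
rewrite /Hierarchy.ball /= /Hierarchy.AbsRing_ball /=.
rewrite Rcomplements.sign_eq_1; last first.
  by apply/RltP; rewrite RminusE subr_gt0.
rewrite /Hierarchy.scal /= /Hierarchy.mult /= !RmultE !mul1r /Hierarchy.abs /=.
apply/RltP; rewrite RabsE.
have fp := RSfg p Dp; have fq := RSfg q Dq.
change (`|Riemann_sum f q - Riemann_sum f p| < e).
move: gp hp gq hq fp fq; rewrite !ltr_norml !ler_norml.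
move=> /andP[? ?] /andP[? ?] /andP[? ?] /andP[? ?] /andP[? ?] /andP[? ?].
by apply/andP; split; lra.
Qed.

(** * Bounded almost everywhere continuous functions are integrable *)

Definition discontinuities (R : realType) (f : R -> R) : set R :=
  [set x | ~ {for x, continuous f}].

(** A form of compactness of [[u, v]] adapted to additive properties of
    intervals: the supremum of the [t] such that [P u t] can neither lie
    strictly before [v] nor fail to be attained, since [P] holds on the short
    intervals around it. *)
Lemma segment_induction (R : realType) (P : R -> R -> Prop) (u v : R) : u < v ->
  (forall r s t, u <= r -> r < s -> s < t -> t <= v ->
     P r s -> P s t -> P r t) ->
  (forall x, u <= x <= v -> exists2 d, 0 < d &
     forall s t, u <= s <= x -> x <= t <= v -> s < t -> t - s < d -> P s t) ->
  P u v.
Proof.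
move=> uv glue loc.
pose A := [set t | u < t <= v /\ P u t].
have hsA : has_sup A.
  split; last by exists v => t [/andP[]].
  have [|d d0 ud] := loc u; first by rewrite lexx ltW.
  exists (Num.min v (u + d / 2)).
  have ut : u < Num.min v (u + d / 2) by rewrite lt_min uv; lra.
  have tv : Num.min v (u + d / 2) <= v by rewrite ge_min lexx.
  split; first by rewrite ut.
  apply: ud => //; rewrite ?lexx//; first by rewrite ltW.
  have : Num.min v (u + d / 2) <= u + d / 2 by rewrite ge_min lexx orbT.
  lra.
set x := sup A.
have Ax t : A t -> t <= x by move=> At; exact: sup_ubound hsA.2 _ At.
have xv : x <= v by apply: (ge_sup hsA.1) => t [/andP[]].
have ux : u <= x.
  by have [t At] := hsA.1; have := Ax _ At; case: At => /andP[? ?] _; lra.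
have [|d d0 xd] := loc x; first by rewrite ux.
have [t At xt] := @sup_adherent _ _ _ (divr_gt0 d0 (ltr0Sn _ 1)) hsA.
have tx := Ax _ At.
rewrite -/x in xt.
case: At => /andP[ut tv] Put.
have [tx'|tx'] := ltP t x; last first.
  have {}tx' : t = x by apply/eqP; rewrite eq_le tx tx'.
  have [xv'|vx] := ltP x v; last by have -> : v = t by lra.
  set t' := Num.min v (x + d / 4).
  have xt' : x < t' by rewrite lt_min xv'; lra.
  have t'd : t' <= x + d / 4 by rewrite ge_min lexx orbT.
  have t'v : t' <= v by rewrite ge_min lexx.
  have : A t'.
    split; first by apply/andP; split; lra.
    apply: (glue u t) => //; first lra.
    by apply: xd; rewrite ?tx' ?lexx ?ux ?(ltW xt')//; lra.
  by move/Ax; lra.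
set t' := Num.min v (x + d / 4).
have xt' : x <= t' by rewrite le_min xv; lra.
have t'd : t' <= x + d / 4 by rewrite ge_min lexx orbT.
have t'v : t' <= v by rewrite ge_min lexx.
have Put' : P u t'.
  apply: (glue u t) => //; first lra.
  by apply: xd; rewrite ?xt' ?t'v ?(ltW ut)//; lra.
have : A t' by split=> //; apply/andP; split; lra.
move=> /Ax t'x.
suff <- : t' = v by [].
by move: t'x; rewrite /t'; case: (leP v); lra.
Qed.

(** Filter convergence in the topology of an abstract [realType] reduces to
    inequalities, in which form continuity at a point of the concrete reals can
    be handled directly. *)
Lemma continuous_forP (R : realType) (f : R -> R) (x : R) :
  {for x, continuous f} <->
  forall e : R, 0 < e ->
    exists2 d : R, 0 < d & forall y : R, `|y - x| < d -> `|f y - f x| < e.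
Proof.
rewrite /prop_for /continuous_at; split=> [/cvgrPdist_lt fx e e0|fx].
  have [d /= d0 xd] := (nbhs_ballP _ _).1 (fx e e0).
  by exists d => // y xy; rewrite distrC; apply: xd; rewrite /ball/= distrC.
apply/cvgrPdist_lt => e e0; apply/nbhs_ballP.
have [d d0 xd] := fx e e0.
by exists d => //= y; rewrite /ball/= distrC => /xd; rewrite distrC.
Qed.

Lemma has_RInt_glue (g1 g2 : Real -> Real) (r s t l1 l2 : Real) :
  r < s -> s < t -> has_RInt g1 r s l1 -> has_RInt g2 s t l2 ->
  has_RInt (fun x : Real => if x <= s then g1 x else g2 x) r t (l1 + l2).
Proof.
move=> rs st g1l g2l.
apply: (@is_RInt_Chasles Hierarchy.R_NormedModule _ r s t l1 l2).
  apply: is_RInt_ext g1l => x [_ /RltP]; rewrite RmaxE (max_r (ltW rs)) => xs.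
  by rewrite ltW.
apply: is_RInt_ext g2l => x [/RltP + _]; rewrite RminE (min_l (ltW st)) => sx.
by rewrite leNgt sx.
Qed.

Lemma has_RInt_const (c s t : Real) : has_RInt (fun=> c) s t (c * (t - s)).
Proof. by rewrite mulrC; exact: (@is_RInt_const Hierarchy.R_NormedModule). Qed.

Lemma negligible_open_cover (R : realType) (N : set R) (e : R) : 0 < e ->
  mu.-negligible N -> exists U : set R, [/\ open U, N `<=` U & (mu U < e%:E)%E].
Proof.
move=> e0 [B [mB B0 NB]].
have Boo : (mu B < +oo)%E by rewrite B0.
have [U [oU BU Ue]] := lebesgue_regularity_outer mB Boo e0.
exists U; split => //; first exact: subset_trans NB BU.
have mU : measurable U by exact: open_measurable.
suff -> : mu U = mu (U `\` B) by [].
rewrite -[in LHS](setDUK BU) measureU//.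
- by rewrite [X in (X + _)%E]B0 add0e.
- exact: measurableD.
- by rewrite setIC setDKI.
Qed.

Lemma negligible_set1 (R : realType) (x : R) : mu.-negligible [set x].
Proof.
exists [set x]; split => //; exact: lebesgue_measure_set1.
Qed.

(** Half-open intervals make this exactly additive in the interval. *)
Definition measure_within (R : realType) (U : set R) (s t : R) : R :=
  fine (mu (U `&` `]s, t])).

Lemma measure_within_le (R : realType) (U : set R) (s t e : R) :
  measurable U -> (mu U <= e%:E)%E -> measure_within U s t <= e.
Proof.
move=> mU Ue.
have le : (mu (U `&` `]s, t]) <= e%:E)%E.
  apply: le_trans Ue; apply: le_measure; rewrite ?inE//.
  exact: measurableI.
by rewrite -lee_fin fineK// ge0_fin_numE//; apply: le_lt_trans le (ltry _).
Qed.

Lemma measure_within_add (R : realType) (U : set R) (r s t : R) :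
  measurable U -> (mu U < +oo)%E -> r < s -> s < t ->
  measure_within U r t = measure_within U r s + measure_within U s t.
Proof.
move=> mU Uoo rs st.
have mI x y : measurable (U `&` `]x, y]) by exact: measurableI.
have fin x y : mu (U `&` `]x, y]) \is a fin_num.
  rewrite ge0_fin_numE//; apply: le_lt_trans Uoo.
  by apply: le_measure; rewrite ?inE//; exact: measurableI.
rewrite /measure_within -fineD//; congr fine.
have disj : U `&` `]r, s] `&` (U `&` `]s, t]) = set0.
  rewrite -subset0 => x [[_ +] [_ +]] /=; rewrite /= !in_itv/=.
  by move=> /andP[_ xs] /andP[]; rewrite ltNge xs.
rewrite -measureU//; [|exact: mI..].
rewrite -setIUr; congr (mu (_ `&` _)).
apply/seteqP; split=> x /=; rewrite !in_itv/=.
  by move=> /andP[-> ->]; rewrite andbT; case: (leP x s); [left|right].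
by move=> [] /andP[? ?]; apply/andP; split; lra.
Qed.

Lemma measure_within_id (R : realType) (U : set R) (s t : R) :
  s < t -> `]s, t] `<=` U -> measure_within U s t = t - s.
Proof.
move=> st /setIidr stU.
by rewrite /measure_within stU lebesgue_measure_itv/= lte_fin st.
Qed.

(** Cover the discontinuities and the endpoints by an open set [U] of measure
    at most [e']. Around a point of [U], approximate [f] by 0 with error [M];
    around any other point, approximate it by its value there with error [e'].
    The integral of the error over a short interval is at most
    [M * mu (U `&` `]s, t]) + e' * (t - s)], which is additive in the interval,
    so that [segment_induction] glues the local approximations. *)
Theorem ex_RInt_of_ae_continuous (u v M : Real) (f : Real -> Real) : u < v ->
  (forall x, u <= x <= v -> `|f x| <= M) ->
  mu.-negligible (`]u, v[ `&` discontinuities f) ->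
  Riemann_integrable_on u v f.
Proof.
move=> uv fM D0.
have M0 : 0 <= M by apply: le_trans (fM u _); rewrite ?normr_ge0// lexx ltW.
apply: ex_RInt_squeeze => // e e0.
(* Chosen so that the total error M * e' + e' * (v - u) is at most e. *)
pose e' := e / (M + (v - u) + 1).
have e'0 : 0 < e' by rewrite divr_gt0//; lra.
have N0 : mu.-negligible
    (`]u, v[ `&` discontinuities f `|` [set u] `|` [set v]).
  by do ![apply: negligibleU]; [exact: D0|exact: negligible_set1..].
have [U [oU NU Ue]] := negligible_open_cover e'0 N0.
have mU : measurable U by exact: open_measurable.
have Uoo : (mu U < +oo)%E by exact: lt_trans Ue (ltry _).
pose m : Real -> Real -> Real := measure_within (R := Real) U.
pose P s t := exists (g h : Real -> Real) (l : Real),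
  [/\ Riemann_integrable_on s t g,
     has_RInt h s t l, l <= M * m s t + e' * (t - s) &
     forall x : Real, s <= x <= t -> `|f x - g x| <= h x].
have [g [h [l [? ? lP ?]]]] : P u v.
  apply: segment_induction uv _ _.
    move=> r s t _ rs st _ [g1 [h1 [l1 [[k1 gk1] hl1 le1 fgh1]]]].
    move=> [g2 [h2 [l2 [[k2 gk2] hl2 le2 fgh2]]]].
    exists (fun x => if x <= s then g1 x else g2 x).
    exists (fun x => if x <= s then h1 x else h2 x), (l1 + l2); split.
    - by exists (k1 + k2); exact: has_RInt_glue.
    - exact: has_RInt_glue.
    - by rewrite /m (measure_within_add mU Uoo rs st) -/m; lra.
    - move=> x /andP[rx xt]; case: (leP x s) => xs.
        by apply: fgh1; rewrite rx.
      by apply: fgh2; rewrite xt ltW.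
  move=> x /andP[ux xv].
  have [Ux|nUx] := pselect (U x).
    have [d /= d0 xd] := (nbhs_ballP _ _).1 (open_nbhs_nbhs (conj oU Ux)).
    exists d => // s t /andP[us sx] /andP[xt tv] st std.
    exists (fun=> 0), (fun=> M), (M * (t - s)); split.
    - exact: (@ex_RInt_const Hierarchy.R_NormedModule).
    - exact: has_RInt_const.
    - have -> : m s t = t - s.
        apply: measure_within_id => //= y /= yst; apply: xd.
        move: yst; rewrite /ball/= in_itv/= => /andP[? ?].
        by rewrite ltr_norml; apply/andP; split; lra.
      by rewrite lerDl mulr_ge0// ?ltW//; lra.
    - move=> y /andP[sy yt]; rewrite subr0; apply: fM.
      by apply/andP; split; lra.
  have fx : {for x, continuous f}.
    apply: contrapT => nfx; apply: nUx; apply: NU.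
    move: ux; rewrite le_eqVlt => /predU1P[<-|ux]; first by left; right.
    move: xv; rewrite le_eqVlt => /predU1P[->|xv]; first by right.
    by left; left; split => //=; rewrite in_itv/= ux.
  have [d d0 xd] := (continuous_forP _ _).1 fx _ e'0.
  exists d => // s t /andP[us sx] /andP[xt tv] st std.
  exists (fun=> f x), (fun=> e'), (e' * (t - s)); split.
  - exact: (@ex_RInt_const Hierarchy.R_NormedModule).
  - exact: has_RInt_const.
  - by rewrite lerDr mulr_ge0// fine_ge0.
  - move=> y /andP[sy yt]; apply/ltW/xd.
    by rewrite ltr_norml; apply/andP; split; lra.
exists g, h, l; split => //.
apply: (le_trans lP).
have muv : m u v <= e' by apply: measure_within_le mU (ltW Ue).
have e'E : e' * (M + (v - u) + 1) = e by rewrite divfK//; lra.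
have := ler_wpM2l M0 muv.
nra.
Qed.

(** * Integrable functions are almost everywhere continuous *)

(** This says that the outer measure of [D] is at most [e]. *)
Definition coverable (R : realType) (D : set R) (e : R) : Prop :=
  exists A : set R, [/\ measurable A, D `<=` A & (mu A <= e%:E)%E].

Lemma coverableS (R : realType) (D E : set R) (e f : R) :
  D `<=` E -> e <= f -> coverable E e -> coverable D f.
Proof.
move=> DE ef [A [mA EA Ae]]; exists A; split => //.
  exact: subset_trans DE EA.
by apply: le_trans Ae _; rewrite lee_fin.
Qed.

Lemma coverable_set0 (R : realType) : coverable (@set0 R) 0.
Proof. by exists set0; split => //; rewrite measure0. Qed.

Lemma coverable_itv (R : realType) (x y : R) : x <= y ->
  coverable `]x, y[ (y - x).
Proof.
move=> xy; exists `]x, y[%classic; split => //.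
rewrite lebesgue_measure_itv/= lte_fin; case: ifP => // _.
by rewrite lee_fin subr_ge0.
Qed.

Lemma coverableU (R : realType) (D E : set R) (e f : R) :
  coverable D e -> coverable E f -> coverable (D `|` E) (e + f).
Proof.
move=> [A [mA DA Ae]] [B [mB EB Bf]]; exists (A `|` B); split.
- exact: measurableU.
- exact: setUSS.
- apply: (@le_trans _ _ (mu A + mu B)%E); first exact: measureU2.
  by rewrite EFinD leeD.
Qed.

Lemma coverable_negligible (R : realType) (N : set R) :
  mu.-negligible N -> coverable N 0.
Proof. by move=> [B [mB B0 NB]]; exists B; split=> //; rewrite B0. Qed.

(** A set of arbitrarily small outer measure lies in the intersection of
    countably many measurable covers. *)
Lemma negligible_coverable (R : realType) (D : set R) :
  (forall e, 0 < e -> coverable D e) -> mu.-negligible D.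
Proof.
move=> De.
have /choice[A HA] : forall n : nat, exists A : set R,
    [/\ measurable A, D `<=` A & (mu A <= (n.+1%:R^-1)%:E)%E].
  by move=> n; apply: De; rewrite invr_gt0.
have mA : measurable (\bigcap_n A n).
  by apply: bigcapT_measurable => n; case: (HA n).
exists (\bigcap_n A n); split => //; last first.
  by move=> x Dx n _; case: (HA n) => _ + _; apply.
apply/eqP; rewrite eq_le measure_ge0 andbT; apply/lee_addgt0Pr => e e0.
rewrite add0e.
have [n ne] : exists n : nat, n.+1%:R^-1 < e.
  exists (Num.trunc e^-1); rewrite invf_plt ?posrE//.
  by rewrite truncnS_gt.
have [mAn _ An] := HA n.
apply: (@le_trans _ _ (mu (A n))); last first.
  by apply: le_trans An _; rewrite lee_fin ltW.
by apply: le_measure; rewrite ?inE//; exact: bigcap_inf.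
Qed.

Lemma pos_Rl_locate (l : list Real) (x : Real) :
  pos_Rl l 0 < x -> x < pos_Rl l (size l).-1 -> ~ List.In x l ->
  exists2 i, (i.+1 < size l)%N & pos_Rl l i < x < pos_Rl l i.+1.
Proof.
elim: l => [|a [|b l] IH] /=; first by move=> /lt_trans /[apply]; rewrite ltxx.
  by move=> /lt_trans /[apply]; rewrite ltxx.
move=> ax xl xNl.
have [xb|bx|xb] := ltgtP x b; first by exists 0%N => //=; rewrite ax.
  have [|i il ix] := IH bx xl; first by move=> ?; apply: xNl; right.
  by exists i.+1.
by exfalso; apply: xNl; right; left.
Qed.

(** Markov's inequality for a step function given by the list [l] of its
    subdivision points and the list [lf] of its values on the open intervals
    between them. The value on a degenerate interval is unconstrained, so
    nonnegativity is only asked of the others. *)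
Lemma Int_SF_cover (lf l : list Real) (d : Real) : 0 < d ->
  size l = (size lf).+1 ->
  (forall i, (i < size lf)%N -> pos_Rl l i <= pos_Rl l i.+1) ->
  (forall i, (i < size lf)%N ->
     pos_Rl l i < pos_Rl l i.+1 -> 0 <= pos_Rl lf i) ->
  @coverable Real [set x | exists i, [/\ (i < size lf)%N,
     pos_Rl l i < x < pos_Rl l i.+1 & d <= pos_Rl lf i]] (Int_SF lf l / d).
Proof.
move=> d0; elim: lf l => [|c lf IH] [|x [|y l]]//= sl ol pl.
  rewrite mul0r; apply: coverableS (@coverable_set0 Real) => // z [i []].
  by rewrite ltn0.
rewrite RplusE RmultE RminusE mulrDl.
have xy : x <= y := ol 0%N isT.
have head : @coverable Real [set z | x < z < y /\ d <= c] (c * (y - x) / d).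
  have [dc|cd] := leP d c.
    have := @coverable_itv Real _ _ xy; apply: coverableS.
      by move=> z [+ _]; rewrite /= in_itv.
    by rewrite ler_pdivlMr// mulrC ler_wpM2r// subr_ge0.
  apply: coverableS (@coverable_set0 Real).
    by move=> z [].
  apply: divr_ge0; last exact: ltW.
  move: (xy); rewrite le_eqVlt => /predU1P[->|xy'].
    by rewrite subrr mulr0.
  by rewrite mulr_ge0 ?subr_ge0//; exact: (pl 0%N).
have tail := IH (y :: l) (eq_add_S _ _ sl)
  (fun i => ol i.+1) (fun i => pl i.+1).
apply: coverableS (coverableU head tail) => //.
by move=> z [[|i] [ilf zi di]]; [left|right; exists i].
Qed.

Lemma adapted_couple_near (phi : Real -> Real) (u v x : Real)
    (l lf : list Real) :
  u < v -> u < x < v -> adapted_couple phi u v l lf -> ~ List.In x l ->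
  exists i d, [/\ (i < size lf)%N, 0 < d, pos_Rl l i < x < pos_Rl l i.+1 &
    forall y, `|y - x| < d -> phi y = pos_Rl lf i].
Proof.
move=> uv /andP[ux xv] [_ [lu [lv [sl cst]]]] xl.
rewrite RminE (min_l (ltW uv)) in lu.
rewrite RmaxE (max_r (ltW uv)) in lv.
have lx : pos_Rl l 0 < x by rewrite lu.
have rx : x < pos_Rl l (size l).-1 by rewrite [pos_Rl l _]lv.
have [i il /andP[li ri]] := pos_Rl_locate lx rx xl.
have ilf : (i < size lf)%N by move: il; rewrite [size l]sl.
exists i, (Num.min (x - pos_Rl l i) (pos_Rl l i.+1 - x)); split => //.
- by rewrite lt_min !subr_gt0 li.
- by rewrite li.
- move=> y; rewrite lt_min !ltr_norml => /andP[/andP[? ?] /andP[? ?]].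
  apply: cst.
    by apply/ssrnat.ltP; rewrite -ltnS prednK// (leq_trans _ il).
  by split; apply/RltP; lra.
Qed.

Lemma finite_negligible (l : list Real) :
  mu.-negligible [set x : Real | List.In x l].
Proof.
elim: l => [|a l IH].
  by exists set0; split => //; rewrite measure0.
apply: negligibleS (negligibleU (negligible_set1 a) IH).
by move=> x /= [->|]; [left|right].
Qed.

(** Having oscillation at least [e] at [x], measured from the value at [x]. *)
Definition oscillates (R : realType) (f : R -> R) (e x : R) : Prop :=
  forall d, 0 < d -> exists2 y, `|y - x| < d & e <= `|f y - f x|.

Lemma discontinuities_bigcup (R : realType) (f : R -> R) :
  discontinuities f `<=` \bigcup_n [set x | oscillates f n.+1%:R^-1 x].
Proof.
move=> x nfx; apply: contrapT => nosc.
apply: nfx; apply/continuous_forP => e e0.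
have ne : (Num.trunc e^-1).+1%:R^-1 < e.
  by rewrite invf_plt ?posrE// truncnS_gt.
have : ~ oscillates f (Num.trunc e^-1).+1%:R^-1 x.
  by move=> osc; apply: nosc; exists (Num.trunc e^-1).
move=> /existsNP[d /not_implyP[d0 nd]]; exists d => // y yd.
apply: le_lt_trans ne; rewrite leNgt; apply/negP => /ltW ey.
by apply: nd; exists y.
Qed.

(** Integrability provides step functions with [|f - phi| <= psi] and [psi] of
    small integral. Off the subdivision points both are constant near [x], so
    that [f] stays within [2 * psi x] of [f x] there; if [f] oscillates by [e]
    then [psi x] is at least [e / 2], which by Markov's inequality happens on a
    set of small measure. *)
Lemma ex_RInt_oscillates_negligible (u v e : Real) (f : Real -> Real) :
  u < v -> 0 < e -> Riemann_integrable_on u v f ->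
  mu.-negligible (`]u, v[ `&` [set x | oscillates (R := Real) f e x]).
Proof.
move=> uv e0 /Coquelicot.RInt.ex_RInt_Reals_0 fi.
apply: negligible_coverable => t t0.
have te0 : 0 < t * (e / 2) by rewrite mulr_gt0// divr_gt0.
have te0' : Rdefinitions.Rlt (Rdefinitions.IZR BinNums.Z0) (t * (e / 2)).
  by apply/RltP.
have [[phi [lphi [lfphi phiP]]] [[psi [lpsi [lfpsi psiP]]] [fphi]]] :=
  fi (RIneq.mkposreal _ te0').
rewrite /= in fphi *.
have uv' : Rdefinitions.Rle u v by apply/RleP/ltW.
rewrite /RiemannInt_SF; case: RIneq.Rle_dec => // _.
rewrite /subdivision /subdivision_val /= => /RltP; rewrite RabsE => psit.
have [ol [lu [lv [sl cst]]]] := psiP.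
rewrite RminE (min_l (ltW uv)) in lu.
rewrite RmaxE (max_r (ltW uv)) in lv.
have {}ol i : (i < size lfpsi)%N -> pos_Rl lpsi i <= pos_Rl lpsi i.+1.
  move=> ilf; apply/RleP/ol/ssrnat.ltP; move: sl; rewrite -/size => ->.
  by rewrite /= ilf.
have fphi' x : u <= x <= v -> `|f x - phi x| <= psi x.
  move=> /andP[/RleP ux /RleP xv]; apply/RleP; rewrite -RabsE; apply: fphi.
  by rewrite RminE RmaxE (min_l (ltW uv)) (max_r (ltW uv)).
have pl i : (i < size lfpsi)%N -> pos_Rl lpsi i < pos_Rl lpsi i.+1 ->
    0 <= pos_Rl lfpsi i.
  move=> ilf lt.
  pose x := (pos_Rl lpsi i + pos_Rl lpsi i.+1) / 2.
  have <- : psi x = pos_Rl lfpsi i.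
    apply: cst; first by apply/ssrnat.ltP; rewrite [Datatypes.length _]sl.
    by split; apply/RltP; rewrite /x; lra.
  apply: le_trans (normr_ge0 _) (fphi' x _).
  have [ui vi] : u <= pos_Rl lpsi i /\ pos_Rl lpsi i.+1 <= v.
    split; apply/RleP.
      rewrite -lu; apply: RList_P5; first by case: psiP.
      apply/pos_Rl_P2; exists i; split => //; apply/ssrnat.ltP.
      by rewrite [Datatypes.length _]sl ltnW.
    rewrite -lv; apply: RList_P7; first by case: psiP.
    apply/pos_Rl_P2; exists i.+1; split => //; apply/ssrnat.ltP.
    by rewrite [Datatypes.length _]sl.
  by rewrite /x; apply/andP; split; lra.
have cov := Int_SF_cover (divr_gt0 e0 (ltr0Sn _ 1)) sl ol pl.
have fin := coverable_negligible
  (negligibleU (finite_negligible lphi) (finite_negligible lpsi)).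
apply: coverableS (coverableU fin cov).
  move=> x [/=]; rewrite in_itv /= => uxv osc.
  have [xphi|xphi] := pselect (List.In x lphi); first by left; left.
  have [xpsi|xpsi] := pselect (List.In x lpsi); first by left; right.
  right.
  have [i [d [_ d0 _ phic]]] := adapted_couple_near uv uxv phiP xphi.
  have [j [d' [jlf d'0 xj psic]]] := adapted_couple_near uv uxv psiP xpsi.
  exists j; split => //.
  pose r := Num.min (Num.min d d') (Num.min (x - u) (v - x)).
  have [|y] := osc r.
    by rewrite !lt_min d0 d'0 !subr_gt0.
  rewrite !lt_min => /andP[/andP[yd yd'] /andP[]]; rewrite !ltr_norml.
  move=> /andP[yu _] /andP[_ yv].
  have fy : `|f y - phi y| <= psi y by apply: fphi'; apply/andP; split; lra.
  have fx : `|f x - phi x| <= psi x.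
    by apply: fphi'; case/andP: uxv => ? ?; apply/andP; split; lra.
  have phix : phi x = pos_Rl lfphi i by apply: phic; rewrite subrr normr0.
  have psix : psi x = pos_Rl lfpsi j by apply: psic; rewrite subrr normr0.
  move: fy fx; rewrite (phic _ yd) (psic _ yd') phix psix !ler_norml.
  move=> /andP[? ?] /andP[? ?]; rewrite ler_normr => /orP[]; lra.
rewrite add0r ler_pdivrMr ?divr_gt0//.
by apply: le_trans (ltW psit); exact: ler_norm.
Qed.

Theorem bounded_of_ex_RInt (u v : Real) (f : Real -> Real) : u < v ->
  Riemann_integrable_on u v f ->
  exists M : Real, forall x, u <= x <= v -> `|f x| <= M.
Proof.
move=> uv /Coquelicot.RInt.ex_RInt_ub[M fM]; exists M => x /andP[ux xv].
apply/RleP; rewrite -RabsE; apply: fM.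
by rewrite RminE RmaxE (min_l (ltW uv)) (max_r (ltW uv)); split; apply/RleP.
Qed.

Theorem ae_continuous_of_ex_RInt (u v : Real) (f : Real -> Real) : u < v ->
  Riemann_integrable_on u v f ->
  mu.-negligible (`]u, v[ `&` discontinuities (R := Real) f).
Proof.
move=> uv fi.
have osc n : mu.-negligible
    (`]u, v[ `&` [set x | oscillates (R := Real) f n.+1%:R^-1 x]).
  by apply: ex_RInt_oscillates_negligible => //; rewrite invr_gt0.
apply: negligibleS (negligible_bigcup osc).
by move=> x [uxv /discontinuities_bigcup[n _ ?]]; exists n.
Qed.

(** * Compositions with a fixed integrable function *)

Lemma discontinuities_comp (R : realType) (f g : R -> R) :
  discontinuities (g \o f) `<=` discontinuities f `|` f @^-1` discontinuities g.
Proof.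
move=> x ngf; apply: contrapT => /not_orP[/contrapT fx /contrapT gfx].
by apply: ngf; exact: continuous_comp.
Qed.

(** Near a point off [K] the indicator is constantly 0, however irregular [S]
    is inside [K]. *)
Lemma discontinuities_indic (R : realType) (K S : set R) :
  closed K -> S `<=` K -> discontinuities (\1_S : R -> R) `<=` K.
Proof.
move=> cK SK x; apply: contra_notP => nKx; apply/continuous_forP => e e0.
have [d /= d0 xd] := (nbhs_ballP _ _).1
  (open_nbhs_nbhs (conj (closed_openC cK) nKx)).
have S0 y : `|y - x| < d -> \1_S y = 0 :> R.
  move=> yx; rewrite indicE memNset// => /SK Ky.
  by apply: (xd y) => //; rewrite /ball/= distrC.
by exists d => // y yx; rewrite !S0 ?subrr ?normr0.
Qed.

Lemma negligible_compl_itv (R : realType) (N : set R) (x y : R) :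
  mu.-negligible N -> x < y -> exists2 z, x < z < y & ~ N z.
Proof.
move=> N0 xy; apply: contrapT => nz.
have : mu.-negligible `]x, y[%classic.
  apply: negligibleS N0 => z; rewrite /= in_itv/= => xzy.
  by apply: contrapT => Nz; apply: nz; exists z.
move=> [B [mB B0 xyB]].
have : (mu `]x, y[ <= mu B)%E by apply: le_measure; rewrite ?inE.
rewrite B0 lebesgue_measure_itv/= lte_fin xy lee_fin; lra.
Qed.

(** Choose a point of [C] in each ball with rational centre and radius of the
    form [1 / (k + 1)] that meets [C]. *)
Lemma dense_sequence (R : realType) (C : set R) (c : R) : C c ->
  exists2 s : nat -> R, (forall n, C (s n)) &
    forall x e, C x -> 0 < e -> exists n, `|s n - x| < e.
Proof.
move=> Cc.
pose near (p : rat * nat) := [set y | C y /\ `|y - ratr p.1| < p.2.+1%:R^-1].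
exists (fun n => if unpickle n is Some p then xget c (near p) else c).
  move=> n; case: unpickle => // p.
  by case: xgetP => [y _ []|].
move=> x e Cx e0.
pose k := Num.trunc (e / 2)^-1.
have ke : k.+1%:R^-1 < e / 2.
  by rewrite invf_plt ?posrE ?divr_gt0// truncnS_gt.
have k0 : 0 < k.+1%:R^-1 :> R by rewrite invr_gt0.
have xk : x - k.+1%:R^-1 < x + k.+1%:R^-1 by rewrite ltrD2l gtrN.
have [q] := rat_in_itvoo xk.
rewrite in_itv/= => /andP[q1 q2].
exists (pickle (q, k)); rewrite pickleK.
move: ke k0 q1 q2; set t : R := k.+1%:R^-1 => ke t0 q1 q2.
case: xgetP => [y _ [_ /=]|/(_ x)[]]; rewrite -/t.
  by rewrite !ltr_norml => /andP[? ?]; apply/andP; split; lra.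
by split => //=; rewrite -/t ltr_norml; apply/andP; split; lra.
Qed.

Lemma closed_image (R : realType) (C : set R) (f : R -> R) : compact C ->
  (forall x, C x -> {for x, continuous f}) -> closed (f @` C).
Proof.
move=> cC fC; apply: compact_closed; first exact: norm_hausdorff.
apply: continuous_compact => //; apply: continuous_in_subspaceT => x.
by rewrite inE => /fC.
Qed.

Lemma negligible_inner (R : realType) (E : set R) : measurable E ->
  (forall C, compact C -> C `<=` E -> mu.-negligible C) -> mu.-negligible E.
Proof.
move=> mE CE; exists E; split => //.
apply/eqP; rewrite eq_le measure_ge0 andbT lebesgue_regularity_inner_sup//.
apply: ge_ereal_sup => _ [C [cC CsE] <-].
have mC : measurable C by exact: compact_measurable.
have [B [mB B0 CB]] := CE C cC CsE.
by rewrite -B0; apply: le_measure; rewrite ?inE.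
Qed.

(** At a continuity point of [f], the preimage of an open set is a
    neighbourhood. Replacing preimages by their interiors therefore loses only
    discontinuity points, and yields a Borel set that [f] still maps into
    arbitrarily small open covers of [N]. *)
Lemma negligible_preimage_hull (R : realType) (f : R -> R) (N : set R) :
  mu.-negligible N -> exists E : set R, [/\ measurable E,
    f @^-1` N `\` discontinuities f `<=` E & mu.-negligible (f @` E)].
Proof.
move=> N0.
have /choice[U HU] : forall n : nat, exists U : set R,
    [/\ open U, N `<=` U & (mu U < (n.+1%:R^-1)%:E)%E].
  by move=> n; apply: negligible_open_cover => //; rewrite invr_gt0.
exists (\bigcap_n (f @^-1` U n)^°); split.
- by apply: bigcapT_measurable => n; apply: open_measurable;
     exact: open_interior.
- move=> x [Nfx /contrapT fx] n _; have [oU NU _] := HU n.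
  by apply: fx; apply: open_nbhs_nbhs; split => //; exact: NU.
- apply: negligible_coverable => e e0; pose n := Num.trunc e^-1.
  have ne : n.+1%:R^-1 < e by rewrite invf_plt ?posrE// truncnS_gt.
  have [oU _ Un] := HU n; exists (U n); split.
  + exact: open_measurable.
  + by move=> _ [x Ex <-]; exact: (interior_subset (Ex n I)).
  + by apply: le_trans (ltW Un) _; rewrite lee_fin ltW.
Qed.

Lemma ex_RInt_indic (c d : Real) (K S : set Real) : c < d ->
  @closed (Real : realType) K -> mu.-negligible K -> S `<=` K ->
  Riemann_integrable_on c d (\1_S : Real -> Real).
Proof.
move=> cd cK K0 SK; apply: (@ex_RInt_of_ae_continuous _ _ 1) => //.
  by move=> x _; rewrite indicE ger0_norm// lern1 leq_b1.
apply: negligibleS K0 => x [_]; exact: (@discontinuities_indic Real K S cK SK).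
Qed.

(** The endpoints [c] and [d] join the exceptional set because the criterion
    gives continuity of [g] only in the interior of [[c, d]]; null sets being
    allowed, this costs nothing. *)
Lemma comp_integrable (a b c d : Real) (f g : Real -> Real) :
  a < b -> c < d -> (forall x, x \in `[a, b] -> f x \in `[c, d]) ->
  Riemann_integrable_on a b f ->
  N_inv_property [set` `[a, b]] f ->
  Riemann_integrable_on c d g -> Riemann_integrable_on a b (g \o f).
Proof.
move=> ab cd fab fi fN gi.
have [M gM] := bounded_of_ex_RInt cd gi.
apply: (@ex_RInt_of_ae_continuous _ _ M) => //.
  by move=> x xab; apply: gM; have := fab x xab; rewrite in_itv.
have g0 := ae_continuous_of_ex_RInt cd gi.
have := fN _
  (negligibleU (negligibleU g0 (negligible_set1 c)) (negligible_set1 d)).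
move=> /(negligibleU (ae_continuous_of_ex_RInt ab fi)); apply: negligibleS.
move=> x [xab /(@discontinuities_comp Real)[fx|gfx]]; [by left|right].
have xab' : x \in `[a, b] := subset_itv_oo_cc xab.
split => //; have := fab _ xab'; rewrite in_itv/= !le_eqVlt => /andP[].
move=> /predU1P[->|cf]; first by left; right.
move=> /predU1P[->|fd]; first by right.
by left; left; split => //=; rewrite in_itv/= cf.
Qed.

(** A continuity point of the composition of [f] with the indicator of [{p}],
    lying in the fibre of [p], is interior to that fibre, which contains no
    interval. *)
Lemma level_set_negligible (a b c d : Real) (f : Real -> Real) (p : Real) :
  a < b -> c < d ->
  ~ constant_on_some_interval [set` `[a, b]] f ->
  (forall g : Real -> Real,
     Riemann_integrable_on c d g -> Riemann_integrable_on a b (g \o f)) ->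
  mu.-negligible ([set` `[a, b]] `&` f @^-1` [set p]).
Proof.
move=> ab cd fnc fcomp.
have gi : Riemann_integrable_on c d (\1_[set p] : Real -> Real).
  by apply: (@ex_RInt_indic _ _ [set p]) => //; exact: negligible_set1.
have := negligibleU (negligibleU (ae_continuous_of_ex_RInt ab (fcomp _ gi))
  (negligible_set1 a)) (negligible_set1 b).
apply: negligibleS => x [/=]; rewrite in_itv/= => /andP[ax xb] fxp.
have [->|xa] := eqVneq x a; first by left; right.
have [->|xb'] := eqVneq x b; first by right.
left; left.
have {}ax : a < x by rewrite lt_neqAle eq_sym xa.
have {}xb : x < b by rewrite lt_neqAle xb'.
split; first by rewrite /= in_itv/= ax.
move=> /(@continuous_forP Real) /(_ 1 ltr01)[e e0 xe]; apply: fnc.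
pose l := Num.max a (x - e); pose r := Num.min b (x + e).
have lx : l < x by rewrite gt_max ax; lra.
have xr : x < r by rewrite lt_min xb; lra.
exists `]l, r[%classic; split.
- exact: interval_is_interval.
- exists x, ((x + r) / 2); rewrite /= !in_itv/=.
  by split; last lra; apply/andP; split; lra.
- move=> y /=; rewrite !in_itv/= gt_max lt_min.
  by move=> /andP[/andP[/ltW -> _] /andP[/ltW -> _]].
- exists p => y; rewrite /= in_itv/= gt_max lt_min.
  move=> /andP[/andP[_ ?] /andP[_ ?]].
  have : `|y - x| < e by rewrite ltr_norml; apply/andP; split; lra.
  have pp : p \in [set p] by exact: mem_set.
  move=> /xe /=; rewrite !indicE fxp pp.
  have [/set_mem//|_] := boolP (f y \in [set p]).
  by rewrite sub0r normrN normr1 ltxx.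
Qed.

(** Testing with the indicator of the whole of [f @` C] would not suffice: [f]
    may take all its values near [C] in a null compact set, as a strictly
    increasing jump function can. The indicator of a countable dense part of
    the image is nonzero densely in [C], and zero almost everywhere once
    composed with [f], which rules out continuity at each point of [C]. *)
Lemma compact_negligible (a b c d : Real) (f : Real -> Real) (C : set Real) :
  a < b -> c < d ->
  ~ constant_on_some_interval [set` `[a, b]] f ->
  (forall g : Real -> Real,
     Riemann_integrable_on c d g -> Riemann_integrable_on a b (g \o f)) ->
  @compact (Real : realType) C ->
  C `<=` `]a, b[ -> (forall x, C x -> ~ discontinuities (R := Real) f x) ->
  mu.-negligible (f @` C) -> mu.-negligible C.
Proof.
move=> ab cd fnc fcomp cC Cab fC fC0.
have [->|/set0P[z0 Cz0]] := eqVneq C set0.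
  by exists set0; split => //; rewrite measure0.
have [s Cs sC] := @dense_sequence Real C z0 Cz0.
pose S := [set f (s n) | n in setT].
have gi : Riemann_integrable_on c d (\1_S : Real -> Real).
  apply: (ex_RInt_indic cd _ fC0).
    by apply: closed_image => // x /fC /contrapT.
  by move=> _ [n _ <-]; exists (s n).
have S0 : mu.-negligible ([set` `[a, b]] `&` f @^-1` S).
  have := negligible_bigcup
    (fun n => level_set_negligible (f (s n)) ab cd fnc fcomp).
  by apply: negligibleS => x [xab [n _ fx]]; exists n.
apply: negligibleS (ae_continuous_of_ex_RInt ab (fcomp _ gi)) => y Cy.
split; first exact: Cab.
have half : 0 < 2^-1 :> Real by rewrite invr_gt0.
move=> /(@continuous_forP Real) /(_ _ half)[e e0 ye].
have [n /ye /=] := sC y e Cy e0.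
have -> : \1_S (f (s n)) = 1 :> Real by rewrite indicE mem_set//; exists n.
have /= := Cab _ Cy; rewrite in_itv/= => /andP[ay yb].
have yr : y < Num.min b (y + e) by rewrite lt_min yb ltrDl.
have [z] := @negligible_compl_itv Real _ _ _ S0 yr.
rewrite lt_min => /andP[yz /andP[zb ze]] nz.
have : `|z - y| < e by rewrite ltr_norml; apply/andP; split; lra.
move=> /ye /=.
have -> : \1_S (f z) = 0 :> Real.
  rewrite indicE memNset// => Sz; apply: nz; split => //=.
  by rewrite in_itv/=; apply/andP; split; lra.
by rewrite !ltr_norml => /andP[? ?] /andP[? ?]; lra.
Qed.

(** [Z] is a Borel null set containing the discontinuities and the endpoints;
    what remains of the preimage of [N] lies in a Borel set all of whose
    compact subsets satisfy the hypotheses of [compact_negligible]. *)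
Lemma N_inv (a b c d : Real) (f : Real -> Real) :
  a < b -> c < d -> Riemann_integrable_on a b f ->
  ~ constant_on_some_interval [set` `[a, b]] f ->
  (forall g : Real -> Real,
     Riemann_integrable_on c d g -> Riemann_integrable_on a b (g \o f)) ->
  N_inv_property [set` `[a, b]] f.
Proof.
move=> ab cd fi fnc fcomp N N0.
have [E [mE NE fE0]] := @negligible_preimage_hull Real f N N0.
have [Z [mZ Z0 DZ]] := negligibleU (negligibleU (ae_continuous_of_ex_RInt ab fi)
  (negligible_set1 a)) (negligible_set1 b).
have E'0 : mu.-negligible ((E `&` `]a, b[) `\` Z).
  apply: (@negligible_inner Real).
    by apply: measurableD => //; exact: measurableI.
  move=> C cC CE; apply: (compact_negligible ab cd fnc fcomp) => //.
  - by move=> x /CE[[]].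
  - by move=> x /CE[[_ xab] nZ] Dx; apply: nZ; apply: DZ; left; left.
  - by apply: negligibleS fE0 => _ [x /CE[[Ex _] _] <-]; exists x.
have Zn : mu.-negligible Z by exists Z; split.
apply: negligibleS (negligibleU E'0 Zn) => x [/=].
rewrite in_itv/= => /andP[ax xb] Nx.
have [Zx|nZx] := pselect (Z x); [by right|left].
have nDx y : (`]a, b[ `&` discontinuities (R := Real) f
    `|` [set a] `|` [set b]) y -> x <> y.
  by move=> /DZ Zy xy; apply: nZx; rewrite xy.
have xab : `]a, b[%classic x.
  rewrite /= in_itv/= !lt_neqAle ax xb !andbT; apply/andP; split; apply/eqP.
    by move=> /esym; apply: nDx; left; right.
  by apply: nDx; right.
split => //; split => //; apply: NE; split => // Dx.
by apply: (nDx x) => //; left; left.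
Qed.

Theorem theorem2p5 (a b c d : Real) (hab : a < b) (hcd : c < d)
    (f : Real -> Real)
    (hf : forall x : Real, x \in `[a, b] -> f x \in `[c, d])
    (hfR : Riemann_integrable_on a b f)
    (hconst : ~ constant_on_some_interval [set` `[a, b]] f) :
  (forall G : Real -> Real,
      Riemann_integrable_on c d G -> Riemann_integrable_on a b (G \o f))
  <-> N_inv_property [set` `[a, b]] f.
Proof.
split; first exact: N_inv hab hcd hfR hconst.
by move=> fN G; exact: comp_integrable hab hcd hf hfR fN.
Qed.
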